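(* Let $k\geqslant 2$ be an integer. Then any bounded injective bilateral weighted shift $W$ in $\ell^2(\mathbb{Z})$ that satisfies the equality $(W^{*}W)^k=(W^{*})^k W^k$ is quasinormal.
   Context: A bilateral weighted shift $W$ in $\ell^2(\mathbb{Z})$ (complex square-summable two-sided sequences) with weights $\{\lambda_n\}_{n=-\infty}^{\infty}\subset\mathbb{C}$ is the product $W=VD$, where $V$ is the bilateral unitary shift of multiplicity $1$, $Ve_n=e_{n+1}$ for $n\in\mathbb{Z}$, $\{e_n\}_{n=-\infty}^{\infty}$ is the standard orthonormal basis of $\ell^2(\mathbb{Z})$, and $D$ is the diagonal operator with diagonal elements $\{\lambda_n\}_{n=-\infty}^{\infty}$; thus $We_n=\lambda_n e_{n+1}$ for all $n\in\mathbb{Z}$. ''Bounded'' means that $W$ is a bounded operator defined on all of $\ell^2(\mathbb{Z})$. A closed densely defined operator $A$ in a complex Hilbert space is called quasinormal if $A$ commutes with the spectral measure $E$ of $|A|=(A^*A)^{1/2}$, i.e. $E(\sigma)A\subset AE(\sigma)$ for all Borel subsets $\sigma$ of $[0,\infty)$. *)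

(* Defs.v *)
From HB Require Import structures.
From mathcomp Require Import all_boot all_order all_algebra.
From mathcomp Require Import complex ring lra.
From mathcomp Require Import all_classical all_reals all_analysis.

Set Implicit Arguments.
Unset Strict Implicit.
Unset Printing Implicit Defensive.

Import Order.TTheory GRing.Theory Num.Theory.
Import numFieldNormedType.Exports.

Local Open Scope classical_set_scope.
Local Open Scope ring_scope.
Local Open Scope complex_scope.

Section two_sided_sums.
Variable R : realType.
Implicit Types (f g : int -> R) (u v : int -> R[i]).

Definition rsummable f : Prop := summable [set: int] (EFin \o f).

(* For rsummable f this is the sum of the absolutely convergent two-sided
   series of f. *)
Definition rsum f : R :=
  fine (\esum_(n in [set: int]) ((EFin \o f)^\+ n)%E)
  - fine (\esum_(n in [set: int]) ((EFin \o f)^\- n)%E).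

Definition csum u : R[i] :=
  rsum (fun n => complex.Re (u n)) +i* rsum (fun n => complex.Im (u n)).

Definition csummable u : Prop :=
  rsummable (fun n => complex.Re (u n)) /\
  rsummable (fun n => complex.Im (u n)).

Lemma rsummable_le f g :
  (forall n, `|f n| <= g n) -> rsummable g -> rsummable f.
Proof.
move=> fg; apply: le_lt_trans; apply: le_esum => n _ /=.
by rewrite lee_fin (le_trans (fg n))// ler_norm.
Qed.

Lemma rsummableD f g : rsummable f -> rsummable g ->
  rsummable (fun n => f n + g n).
Proof. by move=> sf sg; have := summableD sf sg. Qed.

Lemma esumZ (c : R) f : 0 <= c -> (forall n, 0 <= f n) ->
  (\esum_(n in [set: int]) (c * f n)%:E =
   c%:E * \esum_(n in [set: int]) (f n)%:E)%E.
Proof.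
move=> c0 f0; rewrite /esum -ereal_supZl//; last first.
  by apply/set0P; exists (\sum_(x \in set0) (f x)%:E)%E; exists set0 => //; split.
rewrite image_comp; congr (ereal_sup _); apply: eq_imagel => A _ /=.
by rewrite ge0_mule_fsumr// => n; rewrite lee_fin.
Qed.

Lemma rsummableZ c f : rsummable f -> rsummable (fun n => c * f n).
Proof.
rewrite /rsummable /summable => sf.
under eq_esum do rewrite /= normrM.
rewrite esumZ// lte_mul_pinfty//.
Qed.

Lemma rsum_sub f g : (forall n, 0 <= f n) -> (forall n, 0 <= g n) ->
  rsummable f -> rsummable g ->
  rsum (fun n => f n - g n) =
  fine (\esum_(n in [set: int]) (f n)%:E) -
  fine (\esum_(n in [set: int]) (g n)%:E).
Proof.
move=> f0 g0 sf sg.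
have := esumB sf sg (fun i _ => f0 i) (fun i _ => g0 i).
have fin h : (forall n, 0 <= h n)%E -> summable [set: int] h ->
    (\esum_(n in [set: int]) h n \is a fin_num)%E.
  move=> h0; rewrite summableE (_ : esum _ (abse \o h) = esum setT h)//.
  by apply: eq_esum => n _ /=; rewrite gee0_abs.
have sfg := summableB sf sg.
move=> /(congr1 fine); rewrite !fineB//.
- by apply: fin.
- by apply: fin.
- by apply: fin => //; apply: summable_funepos.
- by apply: fin => //; apply: summable_funeneg.
Qed.

Lemma rsum_ge0E f : (forall n, 0 <= f n) -> rsummable f ->
  rsum f = fine (\esum_(n in [set: int]) (f n)%:E).
Proof.
move=> f0 sf; have -> : f = (fun n => f n - 0).
  by apply/funext => n; rewrite subr0.
rewrite rsum_sub//; last first.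
  rewrite /rsummable /summable esum1// => n _ /=; by rewrite normr0.
rewrite [X in _ - fine X]esum1// subr0; congr fine.
by apply: eq_esum => n _; rewrite subr0.
Qed.

Let pos f n := Num.max (f n) 0.
Let neg f n := Num.max (- f n) 0.
Let pos0 f n : 0 <= pos f n. Proof. by rewrite le_max lexx orbT. Qed.
Let neg0 f n : 0 <= neg f n. Proof. by rewrite le_max lexx orbT. Qed.
Let posneg f n : f n = pos f n - neg f n.
Proof.
rewrite /pos /neg; case: (leP (f n) 0) => f0.
  by rewrite max_l ?oppr_ge0// sub0r opprK.
by rewrite max_r ?subr0// oppr_le0 ltW.
Qed.
Let spos f : rsummable f -> rsummable (pos f).
Proof.
move=> sf; apply: (@rsummable_le _ (fun n => `|f n|)); last first.
  by move: sf; rewrite /rsummable /summable; under eq_esum do rewrite /= -normr_id.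
by move=> n; rewrite ger0_norm// /pos ge_max normr_ge0 ler_norm.
Qed.
Let sneg f : rsummable f -> rsummable (neg f).
Proof.
move=> sf; apply: (@rsummable_le _ (fun n => `|f n|)); last first.
  by move: sf; rewrite /rsummable /summable; under eq_esum do rewrite /= -normr_id.
by move=> n; rewrite ger0_norm// /neg ge_max normr_ge0 -normrN ler_norm.
Qed.
Let fin f : (forall n, 0 <= f n) -> rsummable f ->
  (\esum_(n in [set: int]) (f n)%:E)%E \is a fin_num.
Proof.
move=> f0; rewrite /rsummable summableE.
rewrite (_ : esum _ _ = \esum_(n in [set: int]) (f n)%:E)%E//.
by apply: eq_esum => n _ /=; rewrite ger0_norm.
Qed.

Let rsumE f : rsummable f -> rsum f =
  fine (\esum_(n in [set: int]) (pos f n)%:E) -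
  fine (\esum_(n in [set: int]) (neg f n)%:E).
Proof.
move=> sf; rewrite -(rsum_sub (pos0 f) (neg0 f) (spos sf) (sneg sf)).
by congr rsum; apply/funext => n; rewrite -posneg.
Qed.

Lemma rsumD f g : rsummable f -> rsummable g ->
  rsum (fun n => f n + g n) = rsum f + rsum g.
Proof.
move=> sf sg.
have -> : (fun n => f n + g n) =
    (fun n => (pos f n + pos g n) - (neg f n + neg g n)).
  by apply/funext => n; rewrite {1}(posneg f) {1}(posneg g) opprD addrACA.
rewrite rsum_sub.
- have E a b : (forall n, 0 <= a n) -> (forall n, 0 <= b n) ->
      rsummable a -> rsummable b ->
      fine (\esum_(n in [set: int]) (a n + b n)%:E) =
      fine (\esum_(n in [set: int]) (a n)%:E) +
      fine (\esum_(n in [set: int]) (b n)%:E).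
    move=> a0 b0 sa sb; rewrite -fineD ?fin// -esumD//.
    + by move=> n _; rewrite lee_fin.
    + by move=> n _; rewrite lee_fin.
  rewrite (rsumE sf) (rsumE sg).
  rewrite (E _ _ (pos0 f) (pos0 g) (spos sf) (spos sg)).
  rewrite (E _ _ (neg0 f) (neg0 g) (sneg sf) (sneg sg)).
  by rewrite opprD addrACA.
- by move=> n; rewrite addr_ge0.
- by move=> n; rewrite addr_ge0.
- exact: rsummableD (spos sf) (spos sg).
- exact: rsummableD (sneg sf) (sneg sg).
Qed.

Lemma rsumN f : rsummable f -> rsum (fun n => - f n) = - rsum f.
Proof.
move=> sf; rewrite [in LHS](_ : (fun n => - f n) = fun n => neg f n - pos f n).
  by rewrite (rsum_sub (neg0 f) (pos0 f) (sneg sf) (spos sf)) (rsumE sf) opprB.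
by apply/funext => n; rewrite [in LHS]posneg opprB.
Qed.

Lemma rsumZ c f : rsummable f -> rsum (fun n => c * f n) = c * rsum f.
Proof.
wlog c0 : c / 0 <= c => [H sf|sf].
  case: (leP 0 c) => [/H|c0]; first exact.
  have := H (- c); rewrite oppr_ge0 ltW// => /(_ isT sf).
  rewrite mulNr => /(congr1 -%R); rewrite opprK => <-.
  rewrite -rsumN; last exact: rsummableZ.
  by congr rsum; apply/funext => n; rewrite mulNr opprK.
have -> : (fun n => c * f n) = (fun n => c * pos f n - c * neg f n).
  by apply/funext => n; rewrite -mulrBr -posneg.
have sp := spos sf; have sn := sneg sf.
rewrite (rsumE sf) rsum_sub.
- rewrite (esumZ c0 (pos0 f)) (esumZ c0 (neg0 f)).
  by rewrite !fineM ?mulrBr// ?(fin (pos0 f) sp) ?(fin (neg0 f) sn).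
- by move=> n; rewrite mulr_ge0.
- by move=> n; rewrite mulr_ge0.
- exact: rsummableZ.
- exact: rsummableZ.
Qed.

Lemma csummableD u v : csummable u -> csummable v ->
  csummable (fun n => u n + v n).
Proof.
move=> [u1 u2] [v1 v2]; split.
  have := rsummableD u1 v1; congr rsummable; apply/funext => n.
  by case: (u n) (v n) => ? ? [].
have := rsummableD u2 v2; congr rsummable; apply/funext => n.
by case: (u n) (v n) => ? ? [].
Qed.

Lemma csummableZ c u : csummable u -> csummable (fun n => c * u n).
Proof.
move=> [u1 u2]; case: c => a b; split.
  have := rsummableD (rsummableZ a u1) (rsummableZ (- b) u2).
  by congr rsummable; apply/funext => n; case: (u n) => ? ? /=; rewrite mulNr.
have := rsummableD (rsummableZ a u2) (rsummableZ b u1).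
by congr rsummable; apply/funext => n; case: (u n) => ? ? /=; rewrite addrC.
Qed.

Lemma csumD u v : csummable u -> csummable v ->
  csum (fun n => u n + v n) = csum u + csum v.
Proof.
move=> [u1 u2] [v1 v2]; apply/eqP; rewrite eq_complex; apply/andP; split.
  rewrite /= -rsumD//; apply/eqP; congr rsum; apply/funext => n.
  by case: (u n) (v n) => ? ? [].
rewrite /= -rsumD//; apply/eqP; congr rsum; apply/funext => n.
by case: (u n) (v n) => ? ? [].
Qed.

Lemma csumZ c u : csummable u -> csum (fun n => c * u n) = c * csum u.
Proof.
move=> [u1 u2]; case: c => a b; apply/eqP; rewrite eq_complex /=.
rewrite -!rsumZ// -rsumN; last exact: rsummableZ.
rewrite -!rsumD//; try exact: rsummableZ; last first.
  by have := rsummableZ (- b) u2; congr rsummable; apply/funext => n; rewrite mulNr.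
apply/andP; split; apply/eqP; congr rsum; apply/funext => n;
  by case: (u n).
Qed.

Lemma csumJ u : csummable u -> csum (fun n => (u n)^*) = (csum u)^*.
Proof.
move=> [u1 u2]; apply/eqP; rewrite eq_complex /= -rsumN//.
by apply/andP; split; apply/eqP; congr rsum; apply/funext => n; case: (u n).
Qed.

End two_sided_sums.

Section l2_space.
Variable R : realType.
Implicit Types x y : int -> R[i].

Definition sqsummable x : Prop := rsummable (fun n => Normc.normc (x n) ^+ 2).

Definition square_summable : {pred int -> R[i]} := [pred x | `[< sqsummable x >]].

Lemma sqr_normcE (z : R[i]) :
  Normc.normc z ^+ 2 = complex.Re z ^+ 2 + complex.Im z ^+ 2.
Proof. by case: z => a b /=; rewrite sqr_sqrtr// addr_ge0 ?sqr_ge0. Qed.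

Lemma square_summable_submod : submod_closed square_summable.
Proof.
split.
  apply/asboolP; rewrite /sqsummable /rsummable /summable esum1// => n _.
  by rewrite /comp (_ : (0 : int -> R[i]) n = 0)// Normc.normc0 expr0n/= normr0.
move=> a x y /asboolP sx /asboolP sy; apply/asboolP.
apply: (@rsummable_le _ _ (fun n => (2 * Normc.normc a ^+ 2) *
    Normc.normc (x n) ^+ 2 + 2 * Normc.normc (y n) ^+ 2)); last first.
  by apply: rsummableD; apply: rsummableZ.
move=> n; rewrite ger0_norm ?sqr_ge0//.
rewrite -mulrA -exprMn -Normc.normcM -mulrDr !fctE /=.
rewrite (_ : a *: x n = a * x n)// !sqr_normcE.
move: (a * x n) (y n) => u v.
case: u => u1 u2; case: v => v1 v2 /=.
rewrite -subr_ge0.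
have -> : 2 * (u1 ^+ 2 + u2 ^+ 2 + (v1 ^+ 2 + v2 ^+ 2)) -
  ((u1 + v1) ^+ 2 + (u2 + v2) ^+ 2) = (u1 - v1) ^+ 2 + (u2 - v2) ^+ 2 by ring.
by rewrite addr_ge0 ?sqr_ge0.
Qed.

HB.instance Definition _ := GRing.isSubmodClosed.Build R[i] (int -> R[i])
  square_summable square_summable_submod.

End l2_space.

Section l2_type.
Variable R : realType.

Record l2 : Type := L2 {
  l2_val :> int -> R[i] ;
  l2_valP : l2_val \in @square_summable R }.

HB.instance Definition _ := [isSub for l2_val].
HB.instance Definition _ := gen_eqMixin l2.
HB.instance Definition _ := [Choice of l2 by <:].
HB.instance Definition _ := [SubChoice_isSubLmodule of l2 by <:].

Definition l2_dot (x y : l2) : R[i] := csum (fun n => x n * (y n)^*).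

Lemma l2P (x y : l2) : (forall n, x n = y n) -> x = y.
Proof. by move=> xy; apply: val_inj; apply/funext. Qed.

Lemma l2_sqsummable (x : l2) : sqsummable x.
Proof. by have /asboolP := l2_valP x. Qed.

Lemma l2_dot_summable (x y : l2) : csummable (fun n => x n * (y n)^*).
Proof.
have sxy := rsummableD (l2_sqsummable x) (l2_sqsummable y).
have le_sqr (a b c d : R) : `|a * c + b * d| <=
    a ^+ 2 + b ^+ 2 + (c ^+ 2 + d ^+ 2).
  have := sqr_ge0 (a + c); have := sqr_ge0 (a - c).
  have := sqr_ge0 (b + d); have := sqr_ge0 (b - d).
  have := sqr_ge0 a; have := sqr_ge0 b; have := sqr_ge0 c; have := sqr_ge0 d.
  by rewrite ler_norml => *; apply/andP; split; lra.
split; apply: rsummable_le sxy => n; rewrite !sqr_normcE;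
  case: (x n) (y n) => a b [c d] /=.
  by rewrite mulrN opprK.
by have := le_sqr b (- a) c d; rewrite sqrrN mulNr mulrN addrC; congr (_ <= _); rewrite addrC; lra.
Qed.

Lemma l2_dotC (x y : l2) : l2_dot x y = (-1) ^+ false * (l2_dot y x)^*%R.
Proof.
rewrite expr0 mul1r /l2_dot -[RHS]csumJ; last exact: l2_dot_summable.
congr csum; apply/funext => n; case: (x n) (y n) => a b [c d].
by apply/eqP; rewrite eq_complex /=; apply/andP; split; apply/eqP; ring.
Qed.

Lemma l2_dotDZl (y : l2) (a : R[i]) (x x' : l2) :
  l2_dot (a *: x + x') y = a * l2_dot x y + l2_dot x' y.
Proof.
rewrite /l2_dot -csumZ; last exact: l2_dot_summable.
rewrite -csumD; [|exact/csummableZ/l2_dot_summable|exact: l2_dot_summable].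
by congr csum; apply/funext => n; rewrite mulrA -mulrDl.
Qed.

Lemma l2_dot_bilinear :
  bilinear_for (GRing.Scale.Law.clone _ _ *%R _)
    (GRing.Scale.Law.clone _ _ (Num.conj \; *%R) _) l2_dot.
Proof.
split=> [y|x] a u v /=; first exact: l2_dotDZl.
rewrite l2_dotC l2_dotDZl (l2_dotC x u) (l2_dotC x v) !expr0 !mul1r.
by rewrite rmorphD rmorphM.
Qed.

HB.instance Definition _ := bilinear_isBilinear.Build R[i] l2 l2 R[i] _ _
  l2_dot l2_dot_bilinear.
HB.instance Definition _ := isHermitianSesquilinear.Build R[i] l2 false
  Num.conj l2_dot l2_dotC.

Lemma l2_dotxxE (x : l2) : l2_dot x x =
  (fine (\esum_(n in [set: int]) (Normc.normc (x n) ^+ 2)%:E))%:C.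
Proof.
have sx := l2_sqsummable x.
rewrite -(rsum_ge0E _ sx); last by move=> n; rewrite sqr_ge0.
apply/eqP; rewrite eq_complex /=; apply/andP; split; apply/eqP.
  congr rsum; apply/funext => n; rewrite sqr_normcE.
  by case: (x n) => a b /=; ring.
rewrite (_ : (fun n => _) = fun n : int => 0 * Normc.normc (x n) ^+ 2).
  by rewrite (rsumZ _ sx) mul0r.
by apply/funext => n; case: (x n) => a b; rewrite mul0r /=; ring.
Qed.

Lemma l2_dot_gt0 (x : l2) : x != 0 -> 0 < l2_dot x x.
Proof.
move=> x0; have [n xn0] : exists n, x n <> 0.
  apply: contrapT => /forallNP h; move/eqP: x0; apply; apply: l2P => n.
  by have := h n => /contrapT.
have sx := l2_sqsummable x.
rewrite l2_dotxxE ltcR fine_gt0//; apply/andP; split; last first.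
  apply: le_lt_trans sx; apply: le_esum => m _ /=.
  by rewrite lee_fin ler_norm.
apply: (@lt_le_trans _ _ (Normc.normc (x n) ^+ 2)%:E).
  rewrite lte_fin exprn_gt0// lt_neqAle eq_sym; apply/andP; split.
    by apply/eqP => /Normc.eq0_normc.
  by case: (x n) => a b; rewrite sqrtr_ge0.
by apply: esum_ge; exists [set n]; [split|rewrite fsbig_set1].
Qed.

HB.instance Definition _ := isDotProduct.Build R[i] l2 l2_dot l2_dot_gt0.

End l2_type.

Section operators.
Variables (R : realType) (H : lmodType R[i]) (dot : {dot H for @Num.conj R[i]}).
Implicit Types (A B T P : {linear H -> H}) (E : set R -> {linear H -> H}).

Definition hnorm (x : H) : R := Num.sqrt (complex.Re (dot x x)).

Definition bounded_operator A : Prop :=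
  exists M : R, forall x, hnorm (A x) <= M * hnorm x.

Definition adjoint_of A B : Prop := forall x y, dot (A x) y = dot x (B y).

Definition orthogonal_projection P : Prop :=
  adjoint_of P P /\ forall x, P (P x) = P x.

(* The order of R[i] makes 0 <= z say that z is real and nonnegative. *)
Definition positive_operator T : Prop := forall x, 0 <= dot (T x) x.

(* T = (A^* A)^(1/2), the positive square root *)
Definition modulus_of A T : Prop :=
  positive_operator T /\
  exists2 B, adjoint_of A B & forall x, T (T x) = B (A x).

(* A spectral measure on the Borel subsets of [0, +oo[, presented as one on
   the Borel subsets of R that is carried by [0, +oo[; the values of E outside
   the Borel sets are irrelevant. *)
Record spectral_measure_on_nonneg E : Prop := {
  spectral_projection : forall S : set (measurableTypeR R),
    measurable S -> orthogonal_projection (E S) ;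
  spectral_carrier : forall x, E `[0, +oo[%classic x = x ;
  spectral_sigma_additive : forall F : nat -> set (measurableTypeR R),
    (forall n, measurable (F n)) -> trivIset setT F ->
    forall x, hnorm (E (\bigcup_n F n) x - \sum_(i < n) E (F i) x)
      @[n --> \oo] --> (0 : R) }.

(* T = \int t dE(t) on [0, +oo[, through the scalar measures <E(.)x, x>. The
   quadratic form of an operator on a complex space determines the operator. *)
Definition spectral_measure_of T E : Prop :=
  spectral_measure_on_nonneg E /\
  forall x, exists mu : {measure set (measurableTypeR R) -> \bar R},
    (forall S : set (measurableTypeR R), measurable S ->
      (mu S = (complex.Re (dot (E S x) x))%:E)%E) /\
    ((complex.Re (dot (T x) x))%:E = \int[mu]_(t in `[0%R, +oo[) t%:E)%E.

(* For an everywhere defined bounded A the inclusion E(S) A \subset A E(S) of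
   operators is an equality. *)
Definition quasinormal A : Prop :=
  exists T E, [/\ modulus_of A T, spectral_measure_of T E &
    forall S : set (measurableTypeR R), measurable S -> S `<=` `[0, +oo[ ->
      forall x, E S (A x) = A (E S x)].

End operators.

Section shifts.
Variable R : realType.

Lemma shift_sqsummable (x : l2 R) :
  (fun n : int => x (n - 1)) \in @square_summable R.
Proof.
apply/asboolP; have := l2_sqsummable x.
rewrite /sqsummable /rsummable /summable.
rewrite (reindex_esum [set: int] [set: int] (fun n => n - 1))//.
split => //= [n m _ _ /addIr//|n _].
by exists (n + 1); rewrite // addrK.
Qed.

Definition bilateral_shift (x : l2 R) : l2 R := L2 (shift_sqsummable x).

Lemma l2_basis_sqsummable (n : int) :
  (fun m : int => (m == n)%:R) \in @square_summable R.
Proof.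
apply/asboolP; rewrite /sqsummable /rsummable /summable.
rewrite (esumID [set n])// setTI esum_set1// [X in (_ + X)%E]esum1 ?adde0 ?ltry//.
by move=> m [_ /eqP/negPf /= ->]; rewrite Normc.normc0 expr0n/= normr0.
Qed.

Definition l2_basis (n : int) : l2 R := L2 (l2_basis_sqsummable n).

Lemma bilateral_shift_basis (n : int) :
  bilateral_shift (l2_basis n) = l2_basis (n + 1).
Proof. by apply: l2P => m /=; rewrite subr_eq. Qed.

(* D is the diagonal operator with diagonal lambda; a bounded W = V D is
   defined on all of l2, hence so is D. *)
Definition weighted_shift (lambda : int -> R[i]) (W : l2 R -> l2 R) : Prop :=
  exists2 D : l2 R -> l2 R, forall x n, D x n = lambda n * x n &
    W =1 bilateral_shift \o D.

Lemma weighted_shift_basis lambda W : weighted_shift lambda W ->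
  forall n, W (l2_basis n) = lambda n *: l2_basis (n + 1).
Proof.
move=> [D DE WE] n; apply: l2P => m; rewrite WE /= DE /=.
rewrite (_ : (lambda n *: _) m = lambda n * (m == n + 1)%:R)// -subr_eq.
by case: eqP => [->//|_]; rewrite !mulr0.
Qed.

End shifts.

(* Main.v *)
(* Put a_n = |lambda_n|^2 > 0. Comparing matrix entries, the hypothesis says
   a_n^k = a_n a_(n+1) ... a_(n+k-1), so each ln a_n is the mean of its k - 1
   successors. A sequence on Z with this property which is bounded above is
   constant: with b = sup - ln a >= 0 and m = k - 1, the positive combination
   \sum_(0 <= i <= j < m) b_(n+i) does not depend on n, which yields a Harnack
   inequality b_p <= m^3 b_n, while inf b = 0. Hence W^* W is a scalar and the
   spectral measure of |W| is a point mass. *)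
Require Import Defs.
From mathcomp Require Import all_boot all_order all_algebra.
From mathcomp Require Import complex.
From mathcomp Require Import ring lra.
From mathcomp Require Import all_classical all_reals all_analysis.

Import Order.TTheory GRing.Theory Num.Theory.
Import numFieldNormedType.Exports.

Local Open Scope ring_scope.
Local Open Scope complex_scope.

(** * Sequences on the integers with the forward mean property *)

(** The term [u p] occurs in the double sum [C p = C n]. That sum has at most [m ^ 2] terms, each at
    most [m * u n]: for [1 <= i <= m], [u (n + i)] is one of the nonnegative summands of
    [m * u n]. *)
Lemma forward_mean_harnack {R : realFieldType} (m : nat) (u : int -> R) :
  (0 < m)%N -> (forall n, 0 <= u n) ->
  (forall n, m%:R * u n = \sum_(i < m) u (n + i.+1%:Z)) ->
  forall n p, u p <= m%:R ^+ 3 * u n.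
Proof.
move=> m0 u0 uE n p.
pose C n := \sum_(j < m) \sum_(i < j.+1) u (n + i%:Z).
have CS l : C (l + 1) = C l.
  apply/eqP; rewrite -subr_eq0 -sumrB; apply/eqP.
  (* Each inner difference telescopes; summed over [j], what is left vanishes by the mean identity
     at [l]. *)
  transitivity (\sum_(j < m) (u (l + j.+1%:Z) - u l)).
    have uS (i : nat) : u (l + 1 + i%:Z) = u (l + i.+1%:Z).
      by rewrite -addrA -intS.
    apply: eq_bigr => j _.
    rewrite [X in X - _]big_ord_recr [X in _ - X]big_ord_recl /= addr0 uS.
    by under eq_bigr do rewrite uS; ring.
  by rewrite sumrB -uE sumr_const card_ord mulr_natl subrr.
have CE l : C l = C 0.
  elim/int_rect: l => [//|l IH|l IH]; first by rewrite intS addrC CS.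
  by rewrite -[LHS]CS -IH; congr C; rewrite intS; ring.
have uC : u p <= C p.
  case: m m0 @C {uE CS CE} => // m _ C.
  rewrite /C big_ord_recl big_ord1 addr0 lerDl.
  by apply: sumr_ge0 => j _; apply: sumr_ge0.
apply: (le_trans uC); rewrite CE -(CE n).
have um (i : nat) : (i <= m)%N -> u (n + i%:Z) <= m%:R * u n.
  case: i => [_|i im].
    by rewrite addr0 ler_peMl// ler1n.
  rewrite uE (bigD1 (Ordinal im))//= lerDl.
  exact: sumr_ge0.
have -> : m%:R ^+ 3 * u n = \sum_(j < m) \sum_(i < m) (m%:R * u n).
  by rewrite !sumr_const !card_ord -mulrnA -[RHS]mulr_natl natrM; ring.
apply: ler_sum => j _.
rewrite (big_ord_widen m (fun i => u (n + i%:Z)) (ltn_ord j)).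
rewrite [leRHS](bigID (fun i : 'I_m => (i < j.+1)%N))/=.
rewrite -[leLHS]addr0; apply: lerD.
  by apply: ler_sum => i _; apply: um; exact: ltnW.
by apply: sumr_ge0 => i _; rewrite mulr_ge0.
Qed.

(** If some [b p] were below the supremum [s], the Harnack inequality for [s - b] would keep every
    [b n] at distance at least [(s - b p) / m ^ 3] from [s]. *)
Lemma forward_mean_constant {R : realType} (m : nat) (b : int -> R) (M : R) :
  (0 < m)%N -> (forall n, b n <= M) ->
  (forall n, m%:R * b n = \sum_(i < m) b (n + i.+1%:Z)) ->
  forall n, b n = b 0.
Proof.
move=> m0 bM bE.
pose s := sup (range b).
have hb : has_sup (range b).
  by split; [exists (b 0), 0 | exists M => _ [n _ <-]].
have bs n : 0 <= s - b n.
  by rewrite subr_ge0; apply: ub_le_sup; [exact: hb.2 | exists n].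
have m3 : 0 < m%:R ^+ 3 :> R by rewrite exprn_gt0// ltr0n.
suff bE0 p : b p = s by move=> n; rewrite !bE0.
apply/eqP; rewrite eq_le -subr_ge0 bs /= -subr_le0 leNgt; apply/negP => up.
have [_ [n _ <-]] := sup_adherent (divr_gt0 up m3) hb.
apply/negP; rewrite -leNgt lerBrDr -lerBrDl ler_pdivrMr// mulrC.
apply: (@forward_mean_harnack _ _ (fun n => s - b n)) => // l.
by rewrite sumrB sumr_const card_ord mulrBr bE mulr_natl.
Qed.

(** * Coordinates of vectors of [l2] *)

Lemma rsum_single {R : realType} {f : int -> R} (n : int) :
  (forall m, m != n -> f m = 0) -> rsum f = f n.
Proof.
move=> f0; rewrite /rsum.
have single (g : int -> \bar R) : (forall m, 0 <= g m)%E ->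
    (forall m, m != n -> g m = 0)%E -> (\esum_(m in [set: int]) g m = g n)%E.
  move=> g_ge0 g0; rewrite (esumID [set n])// setTI esum_set1//.
  by rewrite [X in (_ + X)%E]esum1 ?adde0// => m [_ /eqP]; exact: g0.
rewrite !single//=.
- rewrite funeposE funenegE -EFinN -!EFin_max /=.
  by case: (leP (f n) 0); case: (leP (- f n) 0); lra.
- by move=> m /f0 fm; rewrite funenegE /= fm oppr0 maxxx.
- by move=> m /f0 fm; rewrite funeposE /= fm maxxx.
Qed.

Lemma l2_dot_basis {R : realType} (n : int) (y : l2 R) :
  l2_dot (l2_basis R n) y = (y n)^*.
Proof.
rewrite /l2_dot /csum /= !(rsum_single n) => [|m /negPf ->|m /negPf ->].
- by rewrite eqxx; case: (y n) => a b; rewrite mul1r.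
- by rewrite mul0r.
- by rewrite mul0r.
Qed.

(** * Operators [A] for which [A^* A] is a scalar *)

Section scalar_operators.
Variables (R : realType) (H : lmodType R[i]) (dot : {dot H for @Num.conj R[i]}).

Definition scalar_spectral_measure (r : R) (S : set R) : {linear H -> H} :=
  (\1_S r)%:C \*: (idfun : H -> H).

(** In the order of [R[i]], [0 <= z] forces the imaginary part of [z] to be 0. *)
Lemma dotxx_re (x : H) : dot x x = (complex.Re (dot x x))%:C.
Proof.
have : 0 <= dot x x by exact: dnorm_ge0.
by case: (dot x x) => a b; rewrite lecE /= => /andP[/eqP -> _].
Qed.

Lemma re_dotxx_ge0 (x : H) : 0 <= complex.Re (dot x x).
Proof. by rewrite -(lecR 0) -dotxx_re; exact: dnorm_ge0. Qed.

Lemma scalar_spectral_measureP (r : R) : 0 <= r ->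
  spectral_measure_of dot (r%:C \*: (idfun : H -> H))
    (scalar_spectral_measure r).
Proof.
move=> r0; split.
  split.
  - move=> S mS; split=> [x y|x] /=.
      by rewrite linearZl_LR linearZr_LR /= /Num.conj /= oppr0.
    rewrite scalerA -rmorphM /= indicE; case: (_ \in _); rewrite ?mulr1 ?mulr0//.
  - by move=> x /=; rewrite indicE mem_set ?scale1r//= in_itv /= r0.
  - move=> F mF tF x.
    (* By disjointness [r] lies in at most one [F i], so the remainder is exactly 0 from [n = i.+1]
       on, or for all [n] if there is no such [i]. *)
    have [[i _ Fi]|nF] := pselect ((\bigcup_n F n)%classic r).
      apply: cvg_near_cst; exists i.+1 => // n /= i_n.
      rewrite indicE mem_set; last by exists i.
      rewrite scale1r (bigD1 (Ordinal i_n))//= indicE mem_set// scale1r.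
      rewrite big1 ?addr0 ?subrr ?/hnorm ?linear0l ?sqrtr0// => j ji.
      rewrite indicE memNset ?scale0r// => Fj.
      by move/eqP: ji; apply; apply/val_inj/(tF j i) => //; exists r.
    apply: cvg_near_cst; exists 0%N => // n _ /=.
    rewrite indicE memNset// scale0r big1 ?subr0 ?/hnorm ?linear0l ?sqrtr0// => j _.
    by rewrite indicE memNset ?scale0r// => Fj; apply: nF; exists j.
move=> x; pose c := NngNum (re_dotxx_ge0 x).
(* The scalar measure of [x] is the mass [dot x x] placed at [r], against which [t] integrates to
   [r * dot x x]. *)
exists (mscale c (\d_ (r : measurableTypeR R))); split.
  move=> S mS; rewrite /= linearZl_LR /= dotxx_re indicE.
  rewrite [LHS](_ : _ = (complex.Re (dot x x))%:E * \d_r S)%E//.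
  by rewrite diracE -EFinM; congr EFin; case: (_ \in _) => /=; ring.
rewrite ge0_integral_mscale//=; last first.
  by move=> t; rewrite in_itv /= andbT lee_fin.
rewrite integral_dirac//.
rewrite diracE mem_set /= ?in_itv /= ?r0// mul1e -EFinM linearZl_LR /= dotxx_re.
by congr EFin => /=; ring.
Qed.

(** The modulus is [sqrt a] times the identity; its spectral projections are 0 or the identity, so
    they commute with every linear map. *)
Lemma quasinormal_scalar (A B : {linear H -> H}) (a : R) : 0 <= a ->
  adjoint_of dot A B -> (forall x, B (A x) = a%:C *: x) -> quasinormal dot A.
Proof.
move=> a0 AB BA.
exists ((Num.sqrt a)%:C \*: (idfun : H -> H)),
  (scalar_spectral_measure (Num.sqrt a)).
split.
- split=> [x|] /=.
    by rewrite linearZl_LR /= mulr_ge0// ?dnorm_ge0// lecR sqrtr_ge0.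
  by exists B => // x; rewrite BA /= scalerA -rmorphM /= -expr2 sqr_sqrtr.
- exact/scalar_spectral_measureP/sqrtr_ge0.
- by move=> S _ _ x /=; rewrite linearZ.
Qed.

End scalar_operators.

(** * Weighted shifts, their adjoints and iterates in coordinates *)

(** Moving [W] across the product of [W e_n] with [y] leaves the conjugate of the coordinate [n] of
    [Wadj y]. *)
Lemma weighted_shift_adjoint {R : realType} {lambda : int -> R[i]}
    {W Wadj : {linear l2 R -> l2 R}} :
  weighted_shift lambda W -> adjoint_of (@l2_dot R) W Wadj ->
  forall (y : l2 R) n, Wadj y n = (lambda n)^* * y (n + 1).
Proof.
move=> hW adj y n; apply: (can_inj (@conjcK R)).
have := adj (l2_basis R n) y.
rewrite (weighted_shift_basis hW) linearZl_LR /= !l2_dot_basis => <-.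
by rewrite rmorphM /= conjcK.
Qed.

Lemma weighted_shift_iter {R : realType} {lambda : int -> R[i]}
    {W : {linear l2 R -> l2 R}} : weighted_shift lambda W ->
  forall k (x : l2 R) n,
    iter k W x (n + k%:Z) = (\prod_(i < k) lambda (n + i%:Z)) * x n.
Proof.
move=> [D DE WE]; elim=> [|k IH] x n; first by rewrite big_ord0 mul1r addr0.
rewrite iterS WE /= DE big_ord_recr /=.
have -> : n + k.+1%:Z - 1 = n + k%:Z by rewrite intS; ring.
by rewrite IH; ring.
Qed.

Lemma weighted_shift_adjoint_iter {R : realType} {lambda : int -> R[i]}
    {W Wadj : {linear l2 R -> l2 R}} :
  weighted_shift lambda W -> adjoint_of (@l2_dot R) W Wadj ->
  forall k (y : l2 R) n,
    iter k Wadj y n = (\prod_(i < k) (lambda (n + i%:Z))^*) * y (n + k%:Z).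
Proof.
move=> hW adj; elim=> [|k IH] y n; first by rewrite big_ord0 mul1r addr0.
rewrite iterSr IH (weighted_shift_adjoint hW adj) big_ord_recr /=.
by rewrite mulrA -addrA intS (addrC 1).
Qed.

Lemma ln_prod {R : realType} (k : nat) (f : nat -> R) :
  (forall i, 0 < f i) -> ln (\prod_(i < k) f i) = \sum_(i < k) ln (f i).
Proof.
move=> f0; elim: k => [|k IH]; first by rewrite !big_ord0 ln1.
by rewrite !big_ord_recr /= lnM ?IH// posrE// prodr_gt0.
Qed.

Lemma mulcJ {R : realType} (z : R[i]) : z^* * z = (Normc.normc z ^+ 2)%:C.
Proof.
rewrite sqr_normcE; case: z => a b; apply/eqP; rewrite eq_complex /=.
by apply/andP; split; apply/eqP; ring.
Qed.

Theorem theorem4p3 (R : realType) (k : nat) (lambda : int -> R[i])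
    (W Wadj : {linear l2 R -> l2 R}) :
  (2 <= k)%N ->
  weighted_shift lambda W ->
  bounded_operator (@l2_dot R) W ->
  injective W ->
  adjoint_of (@l2_dot R) W Wadj ->
  iter k (Wadj \o W) =1 iter k Wadj \o iter k W ->
  quasinormal (@l2_dot R) W.
Proof.
(* With [k = m.+1], [m1] amounts to [0 < m], where [m] is the number of successors averaged. *)
case: k => [//|m] m1 hW [M WM] Winj adj Wk.
pose a n := Normc.normc (lambda n) ^+ 2.
have basis1 n : l2_basis R n n = 1 by rewrite /= eqxx.
have WadjW x n : Wadj (W x) n = (a n)%:C * x n.
  rewrite (weighted_shift_adjoint hW adj) -mulcJ -mulrA.
  by have := weighted_shift_iter hW 1 x n; rewrite big_ord1 addr0 /= => ->.
(* A zero weight would put a basis vector in the kernel of [W]. *)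
have lambda0 n : lambda n != 0.
  apply/eqP => l0; have := weighted_shift_basis hW n; rewrite l0 scale0r.
  rewrite -(linear0 W) => /Winj /(congr1 (fun x : l2 R => x n)).
  by rewrite basis1 => /eqP; rewrite (_ : (0 : l2 R) n = 0)// oner_eq0.
have a0 n : 0 < a n.
  rewrite exprn_gt0// lt_neqAle eq_sym; apply/andP; split.
    by apply: contra_neq (lambda0 n) => /Normc.eq0_normc.
  by case: (lambda n) => c d; rewrite sqrtr_ge0.
have WadjW_iter n j : iter j (Wadj \o W) (l2_basis R n) n = (a n ^+ j)%:C.
  elim: j => [|j IH]; first by rewrite [LHS]basis1 expr0.
  by rewrite iterS [LHS]WadjW IH exprS -rmorphM.
(* This compares the [n]-th diagonal entries of the two sides of the hypothesis. *)
have ak n : a n ^+ m.+1 = \prod_(i < m.+1) a (n + i%:Z).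
  have := congr1 (fun x : l2 R => x n) (Wk (l2_basis R n)).
  rewrite [in X in X -> _]WadjW_iter /comp (weighted_shift_adjoint_iter hW adj).
  rewrite (weighted_shift_iter hW) basis1 mulr1 -big_split /=.
  under eq_bigr do rewrite mulcJ.
  by rewrite -(rmorph_prod (real_complex R)) => -[].
have aM n : a n <= M ^+ 2.
  have := WM (l2_basis R n).
  have h1 l : hnorm (@l2_dot R) (l2_basis R l) = 1.
    by rewrite /hnorm [X in complex.Re X]l2_dot_basis basis1 sqrtr1.
  (* The squared norm of [W e_n] is the [n]-th diagonal entry of [W^* W]. *)
  have -> : hnorm (@l2_dot R) (W (l2_basis R n)) = Num.sqrt (a n).
    rewrite /hnorm; congr (Num.sqrt _).
    rewrite [X in complex.Re X]adj [X in complex.Re X]l2_dot_basis.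
    by rewrite WadjW basis1 mulr1.
  rewrite h1 mulr1 => aM; rewrite -(sqr_sqrtr (ltW (a0 n))).
  by rewrite ler_pXn2r// nnegrE ?sqrtr_ge0// (le_trans _ aM)// sqrtr_ge0.
have M0 : 0 < M ^+ 2 by exact: lt_le_trans (aM 0).
(* The factor [i = 0] of the product is [a n] itself; its logarithm cancels one of the [m.+1] copies
   on the left. *)
have lnaE n : m%:R * ln (a n) = \sum_(i < m) ln (a (n + i.+1%:Z)).
  have := congr1 (@ln R) (ak n); rewrite lnXn//.
  rewrite (ln_prod _ (fun i => a (n + i%:Z)))// big_ord_recl /= addr0.
  by rewrite mulrS mulr_natl => /addrI.
have aE : forall n, a n = a 0.
  move=> n; apply: ln_inj; rewrite ?posrE//.
  apply: (@forward_mean_constant _ _ (fun n => ln (a n)) (ln (M ^+ 2)) m1) => // l.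
  by rewrite ler_ln ?posrE.
apply: (@quasinormal_scalar _ _ _ W Wadj (a 0) (ltW (a0 0)) adj) => x.
by apply: l2P => n; rewrite WadjW aE.
Qed.
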